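(* Let $\Sigma$ be a finite alphabet and let $w_m,w_M\in\Sigma^*$ be words such that $w_m$ embeds uniquely into $w_M$. Let $W=\{w\in\Sigma^*: w_m\le w\le w_M\}$. Then $\mathcal{C}^B_*[W]$ is connected and $H_i(\mathcal{C}^B_*[W])=0$ for all $i\ge 1$.
   Context: $\Sigma^*$ is the set of finite words over $\Sigma$, $1$ denotes the empty word, $x[1]$ is the first symbol of a nonempty word $x$, and $[m]=\{1,\dots,m\}$. For words $x,y$, $y\le x$ means that $y$ is a (scattered) subword of $x$, i.e. $y$ is obtained from $x$ by keeping the symbols at some subset of positions, in order. Unique embedding. Let $w_m\le w_M$ and write $w_M=a_1^{r_1}a_2^{r_2}\cdots a_n^{r_n}$ with $a_i\in\Sigma$, $a_i\ne a_{i+1}$, $r_i\ge1$. We say $w_m$ embeds uniquely into $w_M$ if there is exactly one sequence $q_1,\dots,q_n$ with $0\le q_i\le r_i$ such that $w_m=a_1^{q_1}\cdots a_n^{q_n}$. Blocks. For $m\ge 0$ an $m$-block is a formal expression $\sigma=x_0(1,a_1)x_1(1,a_2)\cdots x_{m-1}(1,a_m)x_m$ with $x_i\in\Sigma^*$, $a_i\in\Sigma$ (an element of $\Sigma^*\times E\times\Sigma^*\times\dots\times E\times\Sigma^*$ with $m$ factors $E=\{(1,a):a\in\Sigma\}$); $\dim\sigma=m$; $0$-blocks are words. Equivalence of $m$-blocks is defined recursively: $0$-blocks are equivalent iff equal as words; for $m\ge1$, writing $\sigma_i=\hat\sigma_i(1,a_i)x_i$ with $\hat\sigma_i$ an $(m-1)$-block,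 $a_i\in\Sigma$, $x_i\in\Sigma^*$, one has $\sigma_1\equiv\sigma_2$ iff $\hat\sigma_1a_1x_1\equiv\hat\sigma_2a_2x_2$ and $\hat\sigma_1x_1\equiv\hat\sigma_2x_2$. A block is in canonical form if for every $i=1,\dots,m$ the word $x_i$ is empty or $x_i[1]\ne a_i$; each equivalence class contains exactly one block in canonical form. Blocks are considered up to equivalence (''='' means equivalent). Sub-blocks and vertices. For disjoint $I^+,I^-\subset[m]$, $\sigma(I^+,I^-)=x_0\lambda_1x_1\cdots\lambda_mx_m$ where $\lambda_i=a_i$ if $i\in I^+$, $\lambda_i=1$ if $i\in I^-$, and $\lambda_i=(1,a_i)$ otherwise; it is an $(m-|I^+|-|I^-|)$-block. For $I\subset[m]$, $v_I(\sigma)=\sigma(I,[m]\setminus I)\in\Sigma^*$, and $V(\sigma)=\{v_I(\sigma):I\subset[m]\}$. Validity. $\sigma$, with canonical form $x_0(1,a_1)x_1\cdots(1,a_m)x_m$, is valid if for every $i=1,\dots,m-1$ with $x_i=1$ one has $a_i\ne a_{i+1}$. Insertion Chain Complex. For $W\subset\Sigma^*$, let $\mathcal{C}^B[W]$ be the set of all valid blocks $\sigma$ with $V(\sigma)\subset W$. The chain complex $\mathcal{C}^B_*[W]$ has as $k$-th chain group the free abelian group on the $k$-dimensional elements of $\mathcal{C}^B[W]$, with boundary $\partial\sigma=\sum_{i=1}^m(-1)^{i+1}\left[\overline F_i(\sigma)-\underline F_i(\sigma)\right]$ for a valid $m$-block with $m\ge1$, where $\overline F_i(\sigma)=\sigma(\{i\},\emptyset)$,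 and $\underline F_i(\sigma)=\sigma(\emptyset,\{i\})$ if this is a valid block and $\underline F_i(\sigma)=0$ otherwise; $\partial=0$ on $0$-blocks. Homology has $\mathbb{Z}$ coefficients. The complex is connected if any two words of $W$ are joined by a path of edges, where the edges are the $1$-blocks of $\mathcal{C}^B[W]$, i.e. pairs of words of $W$ one of which is obtained from the other by inserting a single symbol. *)

(* Defs.v *)
From HB Require Import structures.
From Stdlib Require Import Relation_Operators.
From mathcomp Require Import all_boot all_order all_algebra.
From mathcomp Require Export multinomials.freeg.

Set Implicit Arguments.
Unset Strict Implicit.
Unset Printing Implicit Defensive.

Import GRing.Theory.
Local Open Scope ring_scope.
Local Open Scope quotient_scope.

Notation word T := (seq T).

(* [a_1^r_1 ... a_n^r_n] *)
Definition powers (T : Type) (a : seq T) (r : seq nat) : word T :=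
  flatten [seq nseq p.2 p.1 | p <- zip a r].

Definition run_decomposition (T : finType) (w : word T) (a : seq T)
    (r : seq nat) : Prop :=
  [/\ size r = size a, sorted (fun x y => x != y) a, all (leq 1) r
    & w = powers a r].

Definition embeds_uniquely (T : finType) (wm wM : word T) : Prop :=
  subseq wm wM /\
  exists a r, run_decomposition wM a r /\
    exists! q : seq nat, all2 leq q r /\ wm = powers a q.

Definition subword_interval (T : finType) (wm wM : word T) : word T -> Prop :=
  fun w => subseq wm w && subseq w wM.

(* [Ext s a x] is the formal expression [s (1,a) x]. *)
Inductive block (T : Type) : Type :=
| Word of word T
| Ext of block T & T & word T.

Section Blocks.
Variable T : finType.
Implicit Types (s t : block T) (u x y w : word T) (I J : pred nat).

Fixpoint block_code s : word T * seq (T * word T) :=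
  match s with
  | Word x => (x, [::])
  | Ext s a x => ((block_code s).1, rcons (block_code s).2 (a, x))
  end.

Definition block_decode (p : word T * seq (T * word T)) : block T :=
  foldl (fun s q => Ext s q.1 q.2) (Word p.1) p.2.

Lemma block_codeK : cancel block_code block_decode.
Proof.
elim=> [x|s IHs a x] //=; rewrite /block_decode /= foldl_rcons.
by rewrite -/(block_decode (_, _)) -surjective_pairing IHs.
Qed.

HB.instance Definition _ := Choice.copy (block T) (can_type block_codeK).

Fixpoint dim s : nat := if s is Ext s _ _ then (dim s).+1 else 0.

(* The product [s u] of a block and a word. *)
Definition catw s u : block T :=
  match s with Word x => Word (x ++ u) | Ext s a x => Ext s a (x ++ u) end.

Lemma dim_catw s u : dim (catw s u) = dim s.
Proof. by case: s. Qed.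

Fixpoint bequiv_rec (n : nat) s t : bool :=
  match s, t, n with
  | Word x, Word y, _ => x == y
  | Ext s a x, Ext t b y, n.+1 =>
      bequiv_rec n (catw s (a :: x)) (catw t (b :: y))
      && bequiv_rec n (catw s x) (catw t y)
  | _, _, _ => false
  end.

Definition bequiv s t : bool := bequiv_rec (dim s) s t.

Lemma bequiv_Word x y : bequiv (Word x) (Word y) = (x == y).
Proof. by []. Qed.

Lemma bequiv_Ext s t a b x y :
  bequiv (Ext s a x) (Ext t b y) =
  bequiv (catw s (a :: x)) (catw t (b :: y)) && bequiv (catw s x) (catw t y).
Proof. by rewrite /bequiv !dim_catw. Qed.

(* The sub-block [s(Ip, Im)]; positions are numbered from 1. *)
Fixpoint subblock (Ip Im : pred nat) s : block T :=
  match s with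
  | Word x => Word x
  | Ext s a x =>
      if Ip (dim s).+1 then catw (subblock Ip Im s) (a :: x)
      else if Im (dim s).+1 then catw (subblock Ip Im s) x
      else Ext (subblock Ip Im s) a x
  end.

Fixpoint vertex I s : word T :=
  match s with
  | Word x => x
  | Ext s a x => vertex I s ++ (if I (dim s).+1 then a :: x else x)
  end.

Lemma vertexE I s : subblock I (predC I) s = Word (vertex I s).
Proof. by elim: s => //= s -> a x; case: (I _). Qed.

Fixpoint canonical s : bool :=
  match s with
  | Word _ => true
  | Ext s a x => canonical s && (ohead x != Some a)
  end.

(* The canonical form of [s u], obtained by sliding every [(1, a)] to the right
   past the letters [a] that follow it, starting from the last one. *)
Fixpoint canon_cat s u : block T :=
  match s with
  | Word x => Word (x ++ u)
  | Ext s a x =>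
      let w := x ++ u in
      let k := find (predC1 a) w in
      Ext (canon_cat s (nseq k a)) a (drop k w)
  end.

Definition canon s : block T := canon_cat s [::].

(* [x_i = 1 -> a_i != a_(i+1)], for [0 < i < m]. *)
Fixpoint spaced s : bool :=
  match s with
  | Word _ => true
  | Ext s b _ => spaced s && (if s is Ext _ a [::] then a != b else true)
  end.

Lemma vertex_catw I s u : vertex I (catw s u) = vertex I s ++ u.
Proof. by case: s => //= s a x; case: (I _); rewrite -catA. Qed.

Lemma eq_vertex I J s :
  (forall i, (i <= dim s)%N -> I i = J i) -> vertex I s = vertex J s.
Proof.
elim: s => //= s IHs a x eqIJ.
by rewrite IHs ?eqIJ // => i le_i; apply: eqIJ; apply: leqW.
Qed.

Lemma vertex_Ext I s a x :
  vertex I (Ext s a x) = vertex I (catw s (if I (dim s).+1 then a :: x else x)).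
Proof. by rewrite vertex_catw. Qed.

Lemma bequivP s t :
  bequiv s t <-> dim s = dim t /\ forall I, vertex I s = vertex I t.
Proof.
have [n] := ubnP (dim s); elim: n s t => // n IHn [x|s a x] [y|t b y] /= ltn.
- rewrite bequiv_Word; split=> [/eqP -> //|[_ /(_ predT) /= ->]]; exact: eqxx.
- by split=> [|[]].
- by split=> [|[]].
have IH u v := IHn (catw s u) (catw t v).
rewrite bequiv_Ext; split=> [/andP[]|[[eq_d] eqv]].
  move=> /IH; rewrite !dim_catw => /(_ ltn)[eq_d eq1].
  move=> /IH; rewrite !dim_catw => /(_ ltn)[_ eq0].
  split; first by rewrite eq_d.
  move=> I; rewrite eq_d; case: (I _); first by rewrite -!vertex_catw eq1.
  by rewrite -!vertex_catw eq0.
apply/andP; split; apply/IH; rewrite ?dim_catw //; split=> // I.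
- have := eqv [pred i | (i == (dim s).+1) || I i].
  rewrite /= -!eq_d eqxx /= -!vertex_catw => eqI.
  rewrite (eq_vertex (J := [pred i | (i == (dim s).+1) || I i])) ?eqI.
    apply: eq_vertex => i; rewrite dim_catw -eq_d => le_i /=.
    by case: eqP le_i => // ->; rewrite ltnn.
  move=> i; rewrite dim_catw => le_i /=.
  by case: eqP le_i => // ->; rewrite ltnn.
have := eqv [pred i | (i != (dim s).+1) && I i].
rewrite /= -!eq_d eqxx /= -!vertex_catw => eqI.
rewrite (eq_vertex (J := [pred i | (i != (dim s).+1) && I i])) ?eqI.
  apply: eq_vertex => i; rewrite dim_catw -eq_d => le_i /=.
  by case: eqP le_i => // ->; rewrite ltnn.
by move=> i; rewrite dim_catw => le_i /=; case: eqP le_i => // ->; rewrite ltnn.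
Qed.

Lemma bequiv_refl : reflexive bequiv.
Proof. by move=> s; apply/bequivP. Qed.

Lemma bequiv_sym : symmetric bequiv.
Proof.
by move=> s t; apply/idP/idP => /bequivP[eq_d eqv]; apply/bequivP; split.
Qed.

Lemma bequiv_trans : transitive bequiv.
Proof.
move=> t s r /bequivP[d1 v1] /bequivP[d2 v2]; apply/bequivP.
by split=> [|I]; rewrite ?d1 ?v1.
Qed.

Lemma subblock_bequiv Ip Im s t :
  bequiv s t -> bequiv (subblock Ip Im s) (subblock Ip Im t).
Proof.
pose nd n := count [pred i | ~~ (Ip i || Im i)] (iota 1 n).
have ndS n : nd n.+1 = (nd n + ~~ (Ip n.+1 || Im n.+1))%N.
  by rewrite /nd -[in LHS](addn1 n) iotaD count_cat /= addn0 add1n.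
have dimE r : dim (subblock Ip Im r) = nd (dim r).
  elim: r => //= r IHr a x; rewrite ndS -IHr.
  by case: (Ip _); case: (Im _); rewrite /= ?dim_catw ?addn0 ?addn1.
have vE I r : vertex I (subblock Ip Im r) =
    vertex (fun i => Ip i || ~~ Im i && I (nd i)) r.
  elim: r => //= r IHr a x; rewrite -IHr ndS.
  case: (Ip _) => /=; first by rewrite vertex_catw.
  by case: (Im _) => /=; rewrite ?vertex_catw // dimE addn1.
move=> /bequivP[eq_d eqv]; apply/bequivP.
by rewrite !dimE eq_d; split=> // I; rewrite !vE eqv.
Qed.

Lemma vertex_canon_cat I s u : vertex I (canon_cat s u) = vertex I s ++ u.
Proof.
have dimE r v : dim (canon_cat r v) = dim r.
  by elim: r v => //= r IHr a x v; rewrite IHr.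
elim: s u => //= s IHs a x u; rewrite dimE IHs -!catA; congr (_ ++ _).
set w := x ++ u; set k := find _ w.
have def_w : nseq k a ++ drop k w = w.
  rewrite {}/k; elim: w => //= b w IHw; case: eqP => //= ->.
  by rewrite IHw.
have shift v : nseq k a ++ a :: v = a :: nseq k a ++ v.
  by elim: (k) => //= j ->.
by case: (I _); rewrite ?shift def_w.
Qed.

Lemma canon_bequiv s : bequiv (canon s) s.
Proof.
apply/bequivP; split=> [|I]; last by rewrite vertex_canon_cat cats0.
by rewrite /canon; elim: s [::] => //= s IHs a x u; rewrite IHs.
Qed.

Lemma canon_canonical s : canonical (canon s).
Proof.
rewrite /canon; elim: s [::] => //= s IHs a x u; rewrite IHs /=.
by elim: (x ++ u) => //= b w IHw; case: (eqVneq b a).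
Qed.

Lemma canonical_inj s t : canonical s -> canonical t -> bequiv s t -> s = t.
Proof.
pose vert (bs : seq bool) (l : seq (T * word T)) :=
  flatten [seq (if q.1 then q.2.1 :: q.2.2 else q.2.2) | q <- zip bs l].
have szE r : size (block_code r).2 = dim r.
  by elim: r => //= r IHr a x; rewrite size_rcons IHr.
have vE I r : vertex I r =
    (block_code r).1 ++ vert [seq I i | i <- iota 1 (dim r)] (block_code r).2.
  have iotaS n : iota 1 n.+1 = rcons (iota 1 n) n.+1.
    by rewrite -[in LHS](addn1 n) iotaD add1n cats1.
  rewrite /vert; elim: r => [x|r IHr a x]; first by rewrite /= cats0.
  rewrite [dim _]/= iotaS map_rcons /= zip_rcons ?size_map ?size_iota ?szE //.
  by rewrite map_rcons flatten_rcons IHr -catA.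
have cE r : canonical r = all (fun q => ohead q.2 != Some q.1) (block_code r).2.
  by elim: r => //= r -> a x; rewrite all_rcons andbC.
have slide x y a b x0 y0 : ohead x != Some a -> ohead y != Some b ->
    x0 ++ x = y0 ++ y -> x0 ++ a :: x = y0 ++ b :: y ->
    [/\ x0 = y0, a = b & x = y].
  elim: x0 y0 => [|c x0 IH] [|d y0] //= hx hy.
  - by move=> -> [->].
  - by move=> e [? _]; subst d; rewrite e /= eqxx in hx.
  - by move=> e [? _]; subst c; rewrite -e /= eqxx in hy.
  by move=> [-> e0] [e1]; case: (IH _ hx hy e0 e1) => -> -> ->.
have main : forall l1 l2 x0 y0, size l1 = size l2 ->
    all (fun q => ohead q.2 != Some q.1) l1 ->
    all (fun q => ohead q.2 != Some q.1) l2 ->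
    (forall bs, size bs = size l1 -> x0 ++ vert bs l1 = y0 ++ vert bs l2) ->
    x0 = y0 /\ l1 = l2.
  elim=> [|[a x] l1 IH] [|[b y] l2] x0 y0 //=.
    by move=> _ _ _ /(_ [::] erefl); rewrite /vert /= !cats0.
  move=> [szl] /andP[hx h1] /andP[hy h2] eqv.
  have [e0 e12] : x0 ++ x = y0 ++ y /\ l1 = l2.
    apply: IH => // bs szb; have := eqv (false :: bs); rewrite /vert /= szb.
    by rewrite -!catA; apply.
  have := eqv (nseq (size l1).+1 true); rewrite size_nseq => /(_ erefl).
  rewrite -e12 /vert /= -!cat_cons !catA => /(congr1 rev).
  rewrite ![in rev (_ ++ flatten _)]rev_cat.
  move/eqP; rewrite eqseq_cat // => /andP[_ /eqP/(can_inj revK) e1].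
  by have [-> -> ->] := slide _ _ _ _ _ _ hx hy e0 e1.
rewrite !cE => hs ht /bequivP[eq_d eqv].
apply: (can_inj block_codeK).
case: (main _ _ (block_code s).1 (block_code t).1 _ hs ht).
- by rewrite !szE.
- move=> bs; rewrite szE => szb; have := eqv (fun i => nth false bs i.-1).
  rewrite !vE -eq_d.
  suff -> : [seq nth false bs i.-1 | i <- iota 1 (dim s)] = bs by [].
  rewrite -szb (iotaDl 1 0) -map_comp /=.
  by rewrite [LHS](map_nth_iota0 false) ?take_size.
by case: (block_code s) (block_code t) => [? ?] [? ?] /= -> ->.
Qed.

Lemma bequiv_canon s t : bequiv s t = (canon s == canon t).
Proof.
have E := canon_bequiv; apply/idP/eqP => [st|e].
  apply: canonical_inj; rewrite ?canon_canonical //.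
  by apply: bequiv_trans (E s) _; apply: bequiv_trans st _; rewrite bequiv_sym.
by apply: bequiv_trans (E t); rewrite -e bequiv_sym.
Qed.

Canonical bequiv_equiv :=
  EquivRel bequiv bequiv_refl bequiv_sym bequiv_trans.

(* Blocks up to equivalence. *)
Definition eblock := {eq_quot bequiv}.
HB.instance Definition _ := Quotient.on eblock.
HB.instance Definition _ := Choice.on eblock.
HB.instance Definition _ : EqQuotient _ bequiv eblock := EqQuotient.on eblock.

Implicit Types c : eblock.

Definition edim c : nat := dim (repr c).
Definition esub (Ip Im : pred nat) c : eblock :=
  \pi_eblock (subblock Ip Im (repr c)).
Definition evertex I c : word T := vertex I (repr c).
Definition ecanon c : block T := canon (repr c).

Lemma repr_bequiv s : bequiv (repr (\pi_eblock s)) s.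
Proof. by apply/eqmodP; rewrite reprK. Qed.

Lemma edim_pi s : edim (\pi_eblock s) = dim s.
Proof. by case/bequivP: (repr_bequiv s). Qed.

Lemma esub_pi Ip Im s :
  esub Ip Im (\pi_eblock s) = \pi_eblock (subblock Ip Im s).
Proof. exact/eqmodP/subblock_bequiv/repr_bequiv. Qed.

Lemma evertex_pi I s : evertex I (\pi_eblock s) = vertex I s.
Proof. by case/bequivP: (repr_bequiv s) => _ /(_ I). Qed.

Lemma ecanon_pi s : ecanon (\pi_eblock s) = canon s.
Proof. by apply/eqP; rewrite -bequiv_canon repr_bequiv. Qed.

Definition valid c : bool := spaced (ecanon c).

Definition vertices c (w : word T) : Prop := exists I, w = evertex I c.

(* The set of blocks underlying the complex. *)
Definition in_complex (W : word T -> Prop) c : Prop :=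
  valid c /\ forall w, vertices c w -> W w.

(* Chains live in the free abelian group on all blocks; the k-th chain group is
   the subgroup of those supported on k-dimensional blocks of the complex. *)
Definition chain (W : word T -> Prop) (k : nat) (z : {freeg eblock / int}) :
    Prop :=
  forall c, c \in dom z -> in_complex W c /\ edim c = k.

Definition upper_face (i : nat) c : eblock := esub (pred1 i) pred0 c.
Definition lower_face (i : nat) c : eblock := esub pred0 (pred1 i) c.

Definition block_boundary c : {freeg eblock / int} :=
  \sum_(1 <= i < (edim c).+1)
    (-1) ^+ i.+1 *: (<< upper_face i c >>
                     - (if valid (lower_face i c) then << lower_face i c >>
                        else 0)).

Definition boundary : {freeg eblock / int} -> {freeg eblock / int} :=
  fglift block_boundary.

(* [H_k = 0]: every k-cycle is a k-boundary. *)
Definition homology_vanishes (W : word T -> Prop) (k : nat) : Prop :=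
  forall z, chain W k z -> boundary z = 0 ->
  exists2 y, chain W k.+1 y & boundary y = z.

Definition edge (W : word T -> Prop) u w : Prop :=
  exists c, [/\ in_complex W c, edim c = 1
    & (u = evertex pred0 c /\ w = evertex predT c) \/
      (u = evertex predT c /\ w = evertex pred0 c)].

Definition connected (W : word T -> Prop) : Prop :=
  forall u w, W u -> W w -> clos_refl_trans (word T) (edge W) u w.

End Blocks.

(* Main.v *)
Require Import Defs.
From HB Require Import structures.
From Stdlib Require Import Relation_Operators.
From mathcomp Require Import all_boot ssralg ssrint.

Set Implicit Arguments.
Unset Strict Implicit.
Unset Printing Implicit Defensive.

Import GRing.Theory.
Local Open Scope ring_scope.
Local Open Scope quotient_scope.

(** Write [e_a] for the extended letter [(1, a)]. A block is a word in the
letters [a] and [e_a], and two blocks are equivalent when they agree modulo the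
relations [a e_a = e_a a]. In these terms an invalid block is one of the form
[.. e_a a^j e_a ..], that is, up to equivalence, one with a factor [e_a e_a].
So the chain complex of all words is the ring generated by the [a] and [e_a]
with [a e_a = e_a a] and [e_a e_a = 0], and its boundary is the derivation with
[d a = 0] and [d e_a = a - 1]. The left multiplications [L] by [a] and [E] by
[e_a] satisfy
[[
   d L = L d,   d E = L - 1 - E d,   E L = L E,   E E = 0;
]]
see [boundary_chain_cons], [boundary_chain_ext], [econs_eext] and
[chain_ext_ext]. The second identity makes [E] a homotopy from the identity to
[L], and it also yields [d d = 0].

The theorem follows by induction on the length of [wM]. Let [wM = a w'].

If [wm = a wm'], the uniqueness of the embedding forces every word of the
interval to begin with [a]: a word [v] of the interval that does not begin with
[a] embeds into [wM] without the first run, and then so does [wm], while [wm]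
also embeds with a positive exponent on this run. Hence [L] is an isomorphism
from the complex of the interval from [wm'] to [w'] ([acyclic_cons]).

If [wm] does not begin with [a], let [W] be the interval and [W'] the one from
[wm] to [w']. A block of [W] whose greatest vertex is not below [w'] is [a c]
or [e_a c] with [c] in [W'], so that [W] is [W'] with a cylinder attached, and
the part outside [W'] is matched in pairs ([a c], [e_a c]). Subtracting from a
cycle the boundary of the chain that fills the blocks [a c] by [e_a c] leaves a
cycle without such blocks; the coefficients of its blocks [e_a c] outside [W']
can then be read off from its boundary, and they vanish. So every cycle of [W]
is homologous to one of [W'] ([acyclic_cylinder]).

Both steps preserve the uniqueness of the embedding, and the interval below the
empty word has at most one element. *)

(** * Linear maps on free modules *)

Section FreeModule.
Variables (R : nzRingType) (K : choiceType).
Implicit Types (D : {freeg K / R}) (P Q : K -> Prop).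

Section Lift.
Variables (M : lmodType R) (f : K -> M).

Lemma fglift_sum D : fglift f D = \sum_(x <- dom D) coeff x D *: f x.
Proof.
rewrite -[D in LHS]Freeg_dom fglift_Freeg /prelift big_map.
exact: eq_bigr.
Qed.

Lemma fglift_is_linear : linear (fglift f).
Proof.
have fgliftB := lift_is_additive f.
have fglift0 : fglift f 0 = 0 by rewrite -(subrr 0) fgliftB subrr.
have fgliftN D : fglift f (- D) = - fglift f D.
  by rewrite -(sub0r D) fgliftB fglift0 sub0r.
have fgliftD D1 D2 : fglift f (D1 + D2) = fglift f D1 + fglift f D2.
  by rewrite -{1}(opprK D2) fgliftB fgliftN opprK.
move=> k D1 D2; rewrite fgliftD; congr (_ + _).
rewrite [fglift f D1]fglift_sum scaler_sumr.
have -> : k *: D1 = \sum_(x <- dom D1) << k * coeff x D1 *g x >> by [].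
elim: (dom D1) => [|x r IHr]; first by rewrite !big_nil fglift0.
by rewrite !big_cons fgliftD IHr liftU scalerA.
Qed.

HB.instance Definition _ :=
  GRing.isLinear.Build R {freeg K / R} M *:%R (fglift f) fglift_is_linear.

Lemma fgliftU x : fglift f << x >> = f x.
Proof. by rewrite liftU scale1r. Qed.

End Lift.

Lemma freegUZ k x : << k *g x >> = k *: << x >> :> {freeg K / R}.
Proof. by apply/eqP/freeg_eqP => y; rewrite coeffZ !coeffU mul1r. Qed.

Definition supported P D := forall x, x \in dom D -> P x.

Lemma supported0 P : supported P 0.
Proof. by move=> x; rewrite dom0. Qed.

Lemma supportedU P x : P x -> supported P << x >>.
Proof. by move=> Px y; rewrite domU1 inE => /eqP ->. Qed.

Lemma supportedD P D1 D2 :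
  supported P D1 -> supported P D2 -> supported P (D1 + D2).
Proof.
by move=> P1 P2 x /domD_subset; rewrite mem_cat => /orP[/P1|/P2].
Qed.

Lemma supportedN P D : supported P D -> supported P (- D).
Proof. by move=> PD x; rewrite domN => /PD. Qed.

Lemma supportedB P D1 D2 :
  supported P D1 -> supported P D2 -> supported P (D1 - D2).
Proof. by move=> P1 P2; apply: supportedD => //; apply: supportedN. Qed.

Lemma supportedZ P k D : supported P D -> supported P (k *: D).
Proof. by move=> PD x /domZ_subset /PD. Qed.

Lemma supported_weaken P Q D :
  (forall x, P x -> Q x) -> supported P D -> supported Q D.
Proof. by move=> PQ PD x /PD /PQ. Qed.

Lemma supported_linear P Q D
    (F : {linear {freeg K / R} -> {freeg K / R}}) :
  (forall x, P x -> supported Q (F << x >>)) ->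
  supported P D -> supported Q (F D).
Proof.
move=> PF PD; rewrite -[D]freeg_sumE raddf_sum /= big_seq.
apply: (big_ind (supported Q)) => [||x /PD Px]; first exact: supported0.
- by move=> *; apply: supportedD.
by rewrite freegUZ linearZ; apply: supportedZ; apply: PF.
Qed.

Lemma eq_on_supported P (M : lmodType R) (F G : {linear {freeg K / R} -> M}) D :
  (forall x, P x -> F << x >> = G << x >>) -> supported P D -> F D = G D.
Proof.
move=> eqFG PD; rewrite -[D]freeg_sumE !raddf_sum /=.
apply: eq_big_seq => x /PD Px.
by rewrite freegUZ !linearZ eqFG.
Qed.

Lemma eq_on_generators (M : lmodType R) (F G : {linear {freeg K / R} -> M}) :
  (forall x, F << x >> = G << x >>) -> F =1 G.
Proof. by move=> eqFG D; apply: (eq_on_supported (P := fun=> True)). Qed.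

End FreeModule.

(** * Blocks as words in letters and extended letters *)

Section Blocks.
Variable T : finType.
Local Notation chains := {freeg (eblock T) / int}.
Implicit Types (a b : T) (c d : eblock T) (s t : block T) (z : chains).
Implicit Types (u x y w : word T) (I J : pred nat).

Lemma eblock_ext c d :
  edim c = edim d -> (forall I, evertex I c = evertex I d) -> c = d.
Proof.
by move=> ed ev; rewrite -[c]reprK -[d]reprK; apply/eqmodP/bequivP.
Qed.

(** Left multiplication by the letter [a], and next by [e_a]. The inductive type
of blocks grows on the right, while the proof removes letters on the left. *)
Fixpoint bcons a s : block T :=
  match s with
  | Word x => Word (a :: x)
  | Ext s b x => Ext (bcons a s) b x
  end.

Fixpoint bext a s : block T :=
  match s with
  | Word x => Ext (Word [::]) a x
  | Ext s b x => Ext (bext a s) b x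
  end.

Lemma dim_bcons a s : dim (bcons a s) = dim s.
Proof. by elim: s => //= s -> . Qed.

Lemma dim_bext a s : dim (bext a s) = (dim s).+1.
Proof. by elim: s => //= s -> . Qed.

Lemma vertex_bcons I a s : vertex I (bcons a s) = a :: vertex I s.
Proof. by elim: s => //= s -> b x; rewrite dim_bcons. Qed.

Lemma vertex_bext I a s :
  vertex I (bext a s) = nseq (I 1) a ++ vertex (I \o succn) s.
Proof.
elim: s => [x|s IHs b x] /=; first by case: (I 1).
by rewrite IHs dim_bext catA.
Qed.

(** Every block is a word in letters and extended letters. *)
Lemma block_ind_left (P : block T -> Prop) :
  P (Word [::]) -> (forall a s, P s -> P (bcons a s)) ->
  (forall a s, P s -> P (bext a s)) -> forall s, P s.
Proof.
move=> P0 Pc Pe s.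
pose bdec (l : seq (T * bool)) :=
  foldr (fun p s => if p.2 then bext p.1 s else bcons p.1 s) (Word [::]) l.
have [l ->] : exists l, s = bdec l.
  elim: s => [x|s [l ->] a x].
    by exists [seq (b, false) | b <- x]; elim: x => //= b x <-.
  exists (l ++ (a, true) :: [seq (b, false) | b <- x]).
  elim: l => [|[b []] l /= <-] //=.
  suff <- : Word x = bdec [seq (b, false) | b <- x] by [].
  by elim: x => //= b x <-.
by elim: l => [|[a []] l IHl] //=; [apply: Pe|apply: Pc].
Qed.

Definition econs a c : eblock T := \pi_(eblock T) (bcons a (repr c)).
Definition eext a c : eblock T := \pi_(eblock T) (bext a (repr c)).

Lemma econs_pi a s : econs a (\pi_(eblock T) s) = \pi_(eblock T) (bcons a s).
Proof.
apply/eqmodP/bequivP; case/bequivP: (repr_bequiv s) => ed ev.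
by split=> [|I]; rewrite ?dim_bcons ?vertex_bcons // ev.
Qed.

Lemma eext_pi a s : eext a (\pi_(eblock T) s) = \pi_(eblock T) (bext a s).
Proof.
apply/eqmodP/bequivP; case/bequivP: (repr_bequiv s) => ed ev.
by split=> [|I]; rewrite ?dim_bext ?vertex_bext ?ed // ev.
Qed.

Lemma eblock_ind (P : eblock T -> Prop) :
  P (\pi_(eblock T) (Word [::])) -> (forall a c, P c -> P (econs a c)) ->
  (forall a c, P c -> P (eext a c)) -> forall c, P c.
Proof.
move=> P0 Pc Pe c; rewrite -[c]reprK.
elim/block_ind_left: (repr c) => // a s IHs.
  by rewrite -econs_pi; apply: Pc.
by rewrite -eext_pi; apply: Pe.
Qed.

Lemma edim_econs a c : edim (econs a c) = edim c.
Proof. by rewrite edim_pi dim_bcons. Qed.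

Lemma edim_eext a c : edim (eext a c) = (edim c).+1.
Proof. by rewrite edim_pi dim_bext. Qed.

Lemma evertex_econs I a c : evertex I (econs a c) = a :: evertex I c.
Proof. by rewrite evertex_pi vertex_bcons. Qed.

Lemma evertex_eext I a c :
  evertex I (eext a c) = nseq (I 1) a ++ evertex (I \o succn) c.
Proof. by rewrite evertex_pi vertex_bext. Qed.

Lemma econs_inj a : injective (econs a).
Proof.
move=> c d eq_cd; apply: eblock_ext => [|I].
  by rewrite -(edim_econs a) eq_cd edim_econs.
have := evertex_econs I a c; rewrite eq_cd evertex_econs.
by case.
Qed.

(** Up to this relation, a block determines the word in letters and extended
letters that represents it. *)
Lemma econs_eext a c : econs a (eext a c) = eext a (econs a c).
Proof.
apply: eblock_ext => [|I]; first by rewrite edim_econs !edim_eext edim_econs.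
by rewrite evertex_econs !evertex_eext evertex_econs; case: (I 1).
Qed.

(** * Validity *)

(** Validity read on any representative: no factor [e_b b^j e_b]. *)
Fixpoint nondeg s : bool :=
  match s with
  | Word _ => true
  | Ext s b _ =>
      nondeg s &&
      (if s is Ext _ a y then ~~ ((a == b) && all (pred1 b) y) else true)
  end.

(** The canonical form slides every extended letter to the right through equal
letters, so that two successive [e_b] become adjacent exactly when only letters
[b] separate them. *)
Lemma spaced_canon s : spaced (canon s) = nondeg s.
Proof.
rewrite /canon; elim: s [::] => //= s IHs b x u; rewrite IHs; congr (_ && _).
case: s {IHs} => //= s a y; set k := find _ (x ++ u).
have [-> /=|ne_ab] := eqVneq a b; last by case: (drop _ _).
have drop_nil r : (drop (find (predC1 b) r) r == [::]) = all (pred1 b) r.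
  rewrite -size_eq0 size_drop subn_eq0 leqNgt -has_find -all_predC.
  by apply: eq_all => e /=; rewrite negbK.
have -> : all (pred1 b) y =
    (drop (find (predC1 b) (y ++ nseq k b)) (y ++ nseq k b) == [::]).
  by rewrite drop_nil all_cat all_nseq /= eqxx orbT andbT.
by case: (drop _ _).
Qed.

(** The blocks [a^j e_a ..], on which multiplying by [e_a] on the left gives an
invalid block. *)
Fixpoint starts_ext a s : bool :=
  match s with
  | Word _ => false
  | Ext (Word x) b _ => (a == b) && all (pred1 a) x
  | Ext s _ _ => starts_ext a s
  end.

Lemma starts_ext_bcons a b s :
  starts_ext a (bcons b s) = (a == b) && starts_ext a s.
Proof.
elim: s => [x|[x|s d y] IHs e z] //=; first by rewrite andbF.
by rewrite andbCA (eq_sym a b).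
Qed.

Lemma starts_ext_bext a b s : starts_ext a (bext b s) = (a == b).
Proof.
elim: s => [x|s IHs d y] /=; first by rewrite andbT.
by case: (bext b s) IHs (dim_bext b s).
Qed.

Lemma nondeg_bcons a s : nondeg (bcons a s) = nondeg s.
Proof. by elim: s => //= s ->; case: s. Qed.

Lemma nondeg_bext a s : nondeg (bext a s) = nondeg s && ~~ starts_ext a s.
Proof.
elim: s => //= s -> b x; case: s => [y|s d y] /=.
  by case: eqVneq => // ->.
by rewrite andbAC.
Qed.

Lemma catw_bcons a s u : catw (bcons a s) u = bcons a (catw s u).
Proof. by case: s. Qed.

Lemma catw_bext a s u : catw (bext a s) u = bext a (catw s u).
Proof. by case: s. Qed.

Lemma subblock_bcons Ip Im a s :
  subblock Ip Im (bcons a s) = bcons a (subblock Ip Im s).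
Proof.
elim: s => //= s -> b x; rewrite dim_bcons !catw_bcons.
by case: (Ip _); case: (Im (dim s).+1).
Qed.

Lemma subblock_bext Ip Im a s :
  subblock Ip Im (bext a s) =
  let t := subblock (Ip \o succn) (Im \o succn) s in
  if Ip 1 then bcons a t else if Im 1 then t else bext a t.
Proof.
elim: s => [x|s IHs b x] /=; first by case: (Ip 1); case: (Im 1).
rewrite IHs dim_bext /=.
by case: (Ip 1); case: (Im 1); case: (Ip (dim s).+2); case: (Im (dim s).+2);
  rewrite ?catw_bcons ?catw_bext.
Qed.

Lemma eq_subblock Ip Ip' Im Im' s :
  (forall i, Ip i.+1 = Ip' i.+1) -> (forall i, Im i.+1 = Im' i.+1) ->
  subblock Ip Im s = subblock Ip' Im' s.
Proof. by move=> ep em; elim: s => //= s -> a x; rewrite ep em. Qed.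

Lemma subblock_pred0 s : subblock pred0 pred0 s = s.
Proof. by elim: s => //= s ->. Qed.

(** Replacing extended letters by letters cannot create a first factor
[a^j e_a]; deleting them could. *)
Lemma starts_ext_subblock Ip a s :
  starts_ext a (subblock Ip pred0 s) -> starts_ext a s.
Proof.
elim/block_ind_left: s Ip => // b s IHs Ip.
  by rewrite subblock_bcons !starts_ext_bcons => /andP[-> /IHs].
rewrite subblock_bext starts_ext_bext /=.
case: (Ip 1); last by rewrite starts_ext_bext.
by rewrite starts_ext_bcons => /andP[].
Qed.

Lemma nondeg_subblock Ip s : nondeg s -> nondeg (subblock Ip pred0 s).
Proof.
elim/block_ind_left: s Ip => // b s IHs Ip.
  by rewrite subblock_bcons !nondeg_bcons; apply: IHs.
rewrite subblock_bext nondeg_bext /= => /andP[ns hs].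
case: (Ip 1); first by rewrite nondeg_bcons; apply: IHs.
rewrite nondeg_bext IHs //=.
by apply: contra hs; apply: starts_ext_subblock.
Qed.

Lemma validE s : valid (\pi_(eblock T) s) = nondeg s.
Proof. by rewrite /valid ecanon_pi spaced_canon. Qed.

Lemma valid_repr c : valid c = nondeg (repr c).
Proof. by rewrite -validE reprK. Qed.

Lemma valid_econs a c : valid (econs a c) = valid c.
Proof. by rewrite validE nondeg_bcons -valid_repr. Qed.

Lemma valid_eextW a c : valid (eext a c) -> valid c.
Proof. by rewrite validE nondeg_bext -valid_repr => /andP[]. Qed.

Lemma invalid_eext2 a c : valid (eext a (eext a c)) = false.
Proof. by rewrite eext_pi validE nondeg_bext starts_ext_bext eqxx andbF. Qed.

(** The first [e_a] slides to the front through the letters [a]. *)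
Lemma starts_ext_eext a s :
  starts_ext a s -> exists c, \pi_(eblock T) s = eext a c.
Proof.
elim/block_ind_left: s => // b s IHs.
  rewrite starts_ext_bcons => /andP[/eqP <- /IHs[c ec]].
  by exists (econs a c); rewrite -econs_eext -ec econs_pi.
rewrite starts_ext_bext => /eqP <-.
by exists (\pi_(eblock T) s); rewrite eext_pi.
Qed.

(** The only way in which a product by [e_a] vanishes is [e_a e_a = 0]. *)
Lemma invalid_eextP a c :
  valid c -> ~~ valid (eext a c) -> exists d, c = eext a d.
Proof.
rewrite [valid (eext _ _)]validE nondeg_bext -valid_repr => -> /=.
by rewrite negbK => /starts_ext_eext; rewrite reprK.
Qed.

Lemma valid_eext_upper a c i :
  valid (eext a c) -> valid (eext a (upper_face i c)).
Proof.
rewrite /upper_face /esub eext_pi !validE !nondeg_bext.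
move: (repr c) => s; case/andP=> ns hs.
rewrite (contra _ hs); last exact: starts_ext_subblock.
by rewrite nondeg_subblock.
Qed.

Lemma upper_econs i a c : upper_face i (econs a c) = econs a (upper_face i c).
Proof. by rewrite /upper_face esub_pi subblock_bcons -econs_pi. Qed.

Lemma lower_econs i a c : lower_face i (econs a c) = econs a (lower_face i c).
Proof. by rewrite /lower_face esub_pi subblock_bcons -econs_pi. Qed.

Lemma upper_eext1 a c : upper_face 1 (eext a c) = econs a c.
Proof.
rewrite /upper_face esub_pi subblock_bext /=.
by rewrite (@eq_subblock _ pred0 _ pred0) // subblock_pred0.
Qed.

Lemma lower_eext1 a c : lower_face 1 (eext a c) = c.
Proof.
rewrite /lower_face esub_pi subblock_bext /=.
by rewrite (@eq_subblock _ pred0 _ pred0) // subblock_pred0 reprK.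
Qed.

Lemma upper_eextS i a c :
  upper_face i.+2 (eext a c) = eext a (upper_face i.+1 c).
Proof.
rewrite /upper_face esub_pi subblock_bext /= -eext_pi.
by rewrite (@eq_subblock _ (pred1 i.+1) _ pred0).
Qed.

Lemma lower_eextS i a c :
  lower_face i.+2 (eext a c) = eext a (lower_face i.+1 c).
Proof.
rewrite /lower_face esub_pi subblock_bext /= -eext_pi.
by rewrite (@eq_subblock _ pred0 _ (pred1 i.+1)).
Qed.

(** * The boundary and left multiplication *)

(** Invalid blocks are zero in the complex. *)
Definition valid_gen c : chains := if valid c then << c >> else 0.

Definition chain_cons a : chains -> chains :=
  fglift (fun c => << econs a c >>).
Definition chain_ext a : chains -> chains :=
  fglift (fun c => valid_gen (eext a c)).

HB.instance Definition _ a := GRing.Linear.on (chain_cons a).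
HB.instance Definition _ a := GRing.Linear.on (chain_ext a).
HB.instance Definition _ := GRing.Linear.on (@boundary T).

Lemma chain_consU a c : chain_cons a << c >> = << econs a c >>.
Proof. exact: fgliftU. Qed.

Lemma chain_extU a c : chain_ext a << c >> = valid_gen (eext a c).
Proof. exact: fgliftU. Qed.

Lemma boundaryU c : boundary << c >> = block_boundary c.
Proof. exact: fgliftU. Qed.

Lemma chain_cons_valid a c : chain_cons a (valid_gen c) = valid_gen (econs a c).
Proof.
by rewrite /valid_gen valid_econs; case: ifP; rewrite ?raddf0 ?chain_consU.
Qed.

Lemma chain_ext_valid a c : chain_ext a (valid_gen c) = valid_gen (eext a c).
Proof.
rewrite {1}/valid_gen; case: ifP => [_|nv]; first exact: chain_extU.
rewrite raddf0 /valid_gen ifN //.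
by apply: contraFN nv; apply: valid_eextW.
Qed.

Lemma block_boundaryE c : block_boundary c =
  \sum_(1 <= i < (edim c).+1)
    (-1) ^+ i.+1 *: (<< upper_face i c >> - valid_gen (lower_face i c)).
Proof. by []. Qed.

Lemma boundary_econs a c :
  block_boundary (econs a c) = chain_cons a (block_boundary c).
Proof.
rewrite !block_boundaryE edim_econs linear_sum; apply: eq_bigr => i _.
rewrite linearZ; congr (_ *: _).
by rewrite linearB /= chain_cons_valid chain_consU upper_econs lower_econs.
Qed.

(** The Leibniz rule for [d (e_a c)]. The product by [e_a] drops all invalid
blocks, and the boundary drops the invalid lower faces only; the two agree
because the upper faces of a valid block are valid, and because [e_a c] is
invalid as soon as [c] is. *)
Lemma boundary_eext a c : valid (eext a c) ->
  block_boundary (eext a c) =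
    << econs a c >> - << c >> - chain_ext a (block_boundary c).
Proof.
move=> v; rewrite !block_boundaryE edim_eext big_ltn //.
rewrite upper_eext1 lower_eext1 {1}/valid_gen (valid_eextW v) scale1r.
congr (_ + _); rewrite big_add1 linear_sum -sumrN big_nat [RHS]big_nat.
apply: eq_bigr => i /andP[i0 _].
rewrite exprS mulN1r scaleNr; congr (- _); rewrite linearZ; congr (_ *: _).
rewrite linearB /= chain_ext_valid chain_extU -[i]prednK //.
by rewrite upper_eextS lower_eextS prednK // {2}/valid_gen valid_eext_upper.
Qed.

Lemma chain_ext_ext a z : chain_ext a (chain_ext a z) = 0.
Proof.
apply: (eq_on_generators (F := chain_ext a \o chain_ext a) (G := \0)) => c /=.
by rewrite chain_extU chain_ext_valid /valid_gen invalid_eext2.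
Qed.

Lemma boundary_chain_cons a z :
  boundary (chain_cons a z) = chain_cons a (boundary z).
Proof.
apply: (eq_on_generators (F := @boundary T \o chain_cons a)
  (G := chain_cons a \o @boundary T)) => c /=.
by rewrite chain_consU !boundaryU boundary_econs.
Qed.

End Blocks.

(** * Vertices, faces and intervals *)

Section Intervals.
Variable T : finType.
Local Notation chains := {freeg (eblock T) / int}.
Implicit Types (a b : T) (c d : eblock T) (s : block T) (z : chains).
Implicit Types (u x y w v wm wM : word T) (I J : pred nat).

Lemma eblock_case c :
  [\/ c = \pi_(eblock T) (Word [::]), exists a d, c = econs a d
    | exists a d, c = eext a d].
Proof.
elim/eblock_ind: c => [|a c _|a c _].
- by constructor 1.
- by constructor 2; exists a, c.
by constructor 3; exists a, c.
Qed.

Definition etop c : word T := evertex predT c.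
Definition ebot c : word T := evertex pred0 c.

Lemma etop_econs a c : etop (econs a c) = a :: etop c.
Proof. exact: evertex_econs. Qed.
Lemma ebot_econs a c : ebot (econs a c) = a :: ebot c.
Proof. exact: evertex_econs. Qed.
Lemma etop_eext a c : etop (eext a c) = a :: etop c.
Proof. exact: evertex_eext. Qed.
Lemma ebot_eext a c : ebot (eext a c) = ebot c.
Proof. exact: evertex_eext. Qed.

Lemma subseq_evertex I J c :
  (forall i, I i -> J i) -> subseq (evertex I c) (evertex J c).
Proof.
elim/eblock_ind: c I J => [|a c IHc|a c IHc] I J IJ.
- by rewrite !evertex_pi.
- by rewrite !evertex_econs /= eqxx IHc.
rewrite !evertex_eext cat_subseq //; last by apply: IHc => i; apply: IJ.
by case: (I 1) (IJ 1) => [-> //|]; rewrite /= sub0seq.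
Qed.

Lemma eq_evertex I J c :
  (forall i, I i.+1 = J i.+1) -> evertex I c = evertex J c.
Proof.
elim/eblock_ind: c I J => [|a c IHc|a c IHc] I J IJ.
- by rewrite !evertex_pi.
- by rewrite !evertex_econs (IHc I J).
by rewrite !evertex_eext IJ (IHc _ (J \o succn)) // => i; apply: IJ.
Qed.

Definition proper_face c d : Prop :=
  [/\ valid d, (edim d).+1 = edim c, subseq (ebot c) (ebot d)
    & subseq (etop d) (etop c)].

Lemma boundary_faces c :
  valid c -> supported (proper_face c) (block_boundary c).
Proof.
elim/eblock_ind: c => [|a c IHc|a c IHc] v.
- by rewrite block_boundaryE edim_pi big_geq //; apply: supported0.
- rewrite valid_econs in v; rewrite boundary_econs.
  apply: supported_linear (IHc v) => d [vd dd bd td].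
  rewrite /= chain_consU; apply: supportedU; split.
  + by rewrite valid_econs.
  + by rewrite !edim_econs.
  + by rewrite !ebot_econs /= eqxx.
  by rewrite !etop_econs /= eqxx.
have vc := valid_eextW v.
rewrite boundary_eext //; apply: supportedB; first apply: supportedB.
- apply: supportedU; split.
  + by rewrite valid_econs.
  + by rewrite edim_econs edim_eext.
  + by rewrite ebot_econs ebot_eext subseq_cons.
  by rewrite etop_econs etop_eext.
- apply: supportedU; split=> //.
  + by rewrite edim_eext.
  + by rewrite ebot_eext.
  by rewrite etop_eext subseq_cons.
apply: supported_linear (IHc vc) => d [vd dd bd td].
rewrite /= chain_extU /valid_gen; case: ifP => [vad|_]; last exact: supported0.
apply: supportedU; split=> //.
- by rewrite !edim_eext dd.
- by rewrite !ebot_eext.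
by rewrite !etop_eext /= eqxx.
Qed.

(** Here [e_a c] is allowed to be invalid. Then [c = e_a d], and both sides are
zero: [L c] cancels against [E (L d)], and [c] against [E d]. *)
Lemma boundary_chain_ext a z : supported (fun c => valid c) z ->
  boundary (chain_ext a z) = chain_cons a z - z - chain_ext a (boundary z).
Proof.
apply: (eq_on_supported (F := @boundary T \o chain_ext a)
  (G := chain_cons a \- idfun \- (chain_ext a \o @boundary T))) => c vc /=.
rewrite /= chain_extU chain_consU boundaryU /valid_gen; case: ifPn => [v|nv].
  by rewrite boundaryU boundary_eext.
have [d ed] := invalid_eextP vc nv; rewrite ed in vc nv *.
rewrite raddf0 boundary_eext // [RHS](_ : _ = 0) //.
rewrite !(raddfB (chain_ext a)) /= chain_ext_ext subr0 !chain_extU.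
rewrite {2}/valid_gen vc -econs_eext -chain_cons_valid /valid_gen vc.
by rewrite chain_consU subrr.
Qed.

(** If [d (d c) = 0], then [d (e_a c) = a c - c - E (d c)] gives
[d (d (e_a c)) = L (d c) - d c - (L (d c) - d c - E (d (d c))) = 0]. *)
Lemma boundary_block_boundary c : valid c -> boundary (block_boundary c) = 0.
Proof.
elim/eblock_ind: c => [|a c IHc|a c IHc] v.
- by rewrite block_boundaryE edim_pi big_geq // raddf0.
- rewrite valid_econs in v.
  by rewrite boundary_econs boundary_chain_cons IHc // raddf0.
have vc := valid_eextW v.
rewrite boundary_eext // !raddfB /= boundary_chain_ext; last first.
  by apply: supported_weaken (boundary_faces vc) => d [].
by rewrite IHc // raddf0 subr0 !boundaryU boundary_econs subrr.
Qed.

Lemma boundary_boundary z :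
  supported (fun c => valid c) z -> boundary (boundary z) = 0.
Proof.
apply: (eq_on_supported (F := @boundary T \o @boundary T) (G := \0)) => c vc.
by rewrite /= boundaryU boundary_block_boundary.
Qed.


(** All vertices of a block lie between its least and its greatest vertex. *)
Lemma in_intervalP wm wM c :
  in_complex (subword_interval wm wM) c <->
  [/\ valid c, subseq wm (ebot c) & subseq (etop c) wM].
Proof.
split=> [[vc cW]|[vc mc cM]].
  split=> //.
    have /andP[] // : subword_interval wm wM (ebot c).
    by apply: cW; exists pred0.
  have /andP[] // : subword_interval wm wM (etop c).
  by apply: cW; exists predT.
split=> // _ [I ->]; apply/andP; split.
  by apply: subseq_trans mc _; apply: subseq_evertex.
by apply: subseq_trans cM; apply: subseq_evertex.
Qed.

(** * Removing the first letter of the upper word *)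

Definition acyclic (W : word T -> Prop) : Prop :=
  connected W /\ forall i : nat, (1 <= i)%N -> homology_vanishes W i.

Fixpoint bbehead s : block T :=
  match s with
  | Word x => Word (behead x)
  | Ext s a x => Ext (bbehead s) a x
  end.

Lemma bconsK a : cancel (bcons a) bbehead.
Proof. by elim=> //= s -> b x. Qed.

(** A left inverse of [econs a], the same for all letters [a]. Through the
canonical form it depends on the equivalence class only. *)
Definition euncons c : eblock T := \pi_(eblock T) (bbehead (ecanon c)).

Lemma econsK a : cancel (econs a) euncons.
Proof.
move=> c; rewrite /euncons ecanon_pi.
have -> : canon (bcons a (repr c)) = bcons a (canon (repr c)).
  by rewrite /canon; elim: (repr c) [::] => //= s IHs b x u; rewrite IHs.
rewrite bconsK -[RHS]reprK; apply/eqmodP; exact: canon_bequiv.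
Qed.

(** If [c] begins with [e_b], then [b = a] because of the greatest vertex.
Evaluating [e_b] to the empty word shows that [a] or [e_a] comes next, and
validity excludes [e_a]. So [c = e_a a d = a e_a d]. *)
Lemma evertex_start_econs a c :
  valid c -> (forall I, ohead (evertex I c) = Some a) ->
  exists d, c = econs a d.
Proof.
case: (eblock_case c) => [->|[b [d ->]]|[b [d ->]]].
- by move=> _ /(_ predT); rewrite evertex_pi.
- by move=> _ /(_ predT); rewrite evertex_econs => -[->]; exists d.
move=> v start; have := start predT; rewrite evertex_eext => -[eba]; subst b.
case: (eblock_case d) start v => [->|[b [e ->]]|[b [e ->]]] start.
- by have := start pred0; rewrite evertex_eext evertex_pi.
- have := start pred0; rewrite evertex_eext evertex_econs => -[->] _.
  by exists (eext a e); rewrite econs_eext.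
(* The vertex that omits the first extended letter and keeps the second. *)
have := start [pred i | i != 1%N]; rewrite !evertex_eext => -[->].
by rewrite invalid_eext2.
Qed.

(** The vertices of [c] are vertices of [e_a c], so they all begin with [a].
Hence [c = a e], and [a] can be cancelled in [a d = e_a a e = a e_a e]. *)
Lemma econs_eq_eext a c d : valid (eext a c) -> econs a d = eext a c ->
  exists e, d = eext a e.
Proof.
move=> v e_dc; case: (@evertex_start_econs a c (valid_eextW v)) => [I|e ec].
  (* [I] shifted by one position, with the first extended letter omitted. *)
  have := evertex_eext (fun i => if i is j.+2 then I j.+1 else false) a c.
  rewrite -e_dc evertex_econs /= (_ : evertex _ c = evertex I c) => [<- //|].
  by apply: eq_evertex.
by exists e; apply: (@econs_inj _ a); rewrite e_dc ec econs_eext.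
Qed.

Lemma edge_econs a wm wM u w : edge (subword_interval wm wM) u w ->
  edge (subword_interval (a :: wm) (a :: wM)) (a :: u) (a :: w).
Proof.
move=> [c [/in_intervalP[v mc cM] dc uw]]; exists (econs a c); split.
- apply/in_intervalP; rewrite valid_econs ebot_econs etop_econs /= eqxx.
  by split.
- by rewrite edim_econs.
by rewrite !evertex_econs; case: uw => -[-> ->]; [left|right].
Qed.

Lemma chain_econs a wm wM k z : chain (subword_interval wm wM) k z ->
  chain (subword_interval (a :: wm) (a :: wM)) k (chain_cons a z).
Proof.
apply: supported_linear => c [/in_intervalP[v mc cM] dc].
rewrite /= chain_consU; apply: supportedU; split; last by rewrite edim_econs.
by apply/in_intervalP; rewrite valid_econs ebot_econs etop_econs /= eqxx.
Qed.

(** Left multiplication by [a] is an isomorphism of complexes from the interval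
of [wm] and [wM] onto that of [a :: wm] and [a :: wM]; it is onto by
[evertex_start_econs]. *)
Lemma acyclic_cons a wm wM :
  (forall w, subword_interval (a :: wm) (a :: wM) w -> ohead w = Some a) ->
  acyclic (subword_interval wm wM) ->
  acyclic (subword_interval (a :: wm) (a :: wM)).
Proof.
move=> start [conn van]; split=> [u w Wu Ww|k k0 z Wz dz].
  case: u Wu (start _ Wu) => // b u Wu [eb]; subst b.
  case: w Ww (start _ Ww) => // b w Ww [eb]; subst b.
  move: Wu Ww; rewrite /subword_interval /= !eqxx => Wu Ww.
  elim: (conn u w Wu Ww) => [u' w' uw|u'|u' v' w' _ IH1 _ IH2].
  - exact/rt_step/edge_econs.
  - exact: rt_refl.
  exact: rt_trans IH1 IH2.
pose L := fglift (fun c => << euncons c >>) : chains -> chains.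
have LK : cancel (chain_cons a) L.
  apply: (eq_on_generators (F := L \o chain_cons a) (G := idfun)) => c /=.
  by rewrite chain_consU /L fgliftU econsK.
have inW c : in_complex (subword_interval (a :: wm) (a :: wM)) c ->
    in_complex (subword_interval wm wM) (euncons c) /\ c = econs a (euncons c).
  move=> Wc; have [vc cW] := Wc.
  case: (@evertex_start_econs a c) => // [I|d ed].
    by apply: start; apply: cW; exists I.
  move: Wc; rewrite ed econsK => /in_intervalP.
  rewrite valid_econs ebot_econs etop_econs /= eqxx => Wd; split=> //.
  exact/in_intervalP.
have LW : chain (subword_interval wm wM) k (L z).
  apply: supported_linear Wz => c [/inW[Wd {1}->]]; rewrite edim_econs => dd.
  by rewrite /= /L fgliftU; apply: supportedU.
have LKz : chain_cons a (L z) = z.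
  apply: (eq_on_supported (F := chain_cons a \o L) (G := idfun)) Wz.
  move=> c [/inW[_ ec] _].
  by rewrite /= /L fgliftU chain_consU -ec.
have [|y Wy dy] := van k k0 (L z) LW.
  by rewrite -[LHS]LK -boundary_chain_cons LKz dz /L raddf0.
by exists (chain_cons a y); [apply: chain_econs|rewrite boundary_chain_cons dy].
Qed.

Lemma subseq_skip a wm w :
  ohead wm != Some a -> subseq wm (a :: w) = subseq wm w.
Proof.
case: wm => [|b wm] /=; first by rewrite sub0seq.
by case: (eqVneq b a) => // ->; rewrite eqxx.
Qed.

Section Cylinder.
Variables (a : T) (wm wM : word T).
Hypothesis wm_a : ohead wm != Some a.

Let W := subword_interval wm (a :: wM).
Let W' := subword_interval wm wM.

Lemma subW' w : W' w -> W w.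
Proof.
case/andP=> m M; rewrite /W /subword_interval m.
by rewrite (subseq_trans M) ?subseq_cons.
Qed.

Lemma in_W' c : in_complex W c -> subseq (etop c) wM -> in_complex W' c.
Proof. by case/in_intervalP=> v m _ M; apply/in_intervalP. Qed.

Lemma in_W c : in_complex W' c -> in_complex W c.
Proof. by case=> v cW; split=> // w /cW /subW'. Qed.

Lemma in_W_econs c : in_complex W (econs a c) <-> in_complex W' c.
Proof.
split=> /in_intervalP[v m M]; apply/in_intervalP; move: v m M;
  by rewrite valid_econs ebot_econs etop_econs subseq_skip //= eqxx.
Qed.

Lemma in_W_eext c :
  in_complex W (eext a c) <-> valid (eext a c) /\ in_complex W' c.
Proof.
split=> [/in_intervalP[v m M]|[v] /in_intervalP[_ m M]].
  split=> //; apply/in_intervalP; move: m M.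
  by rewrite ebot_eext etop_eext /= eqxx (valid_eextW v).
by apply/in_intervalP; rewrite ebot_eext etop_eext /= eqxx.
Qed.

Lemma cylinder_cases c : in_complex W c ->
  [\/ subseq (etop c) wM,
      exists2 d, c = econs a d & in_complex W' d
    | exists2 d, c = eext a d & in_complex W' d].
Proof.
move=> Wc; have [_ _] := (in_intervalP _ _ _).1 Wc.
case: (eblock_case c) Wc => [->|[b [d ->]]|[b [d ->]]] Wc.
- by move=> _; constructor 1; rewrite /etop evertex_pi sub0seq.
- rewrite etop_econs /=; case: eqP Wc => [->|_ _]; last by constructor 1.
  by move=> /in_W_econs Wd _; constructor 2; exists d.
rewrite etop_eext /=; case: eqP Wc => [->|_ _]; last by constructor 1.
by move=> /in_W_eext[_ Wd] _; constructor 3; exists d.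
Qed.

(** The pairing of the blocks outside [W']: [a d] is sent to [e_a d], all other
blocks to zero. When [d = e_a e], the block [a d = e_a (a e)] already belongs to
the other half of the pairing, and [e_a d] is zero, as it should be. *)
Definition fill c : chains :=
  if subseq (etop c) wM then 0
  else if econs a (euncons c) == c then valid_gen (eext a (euncons c)) else 0.
Definition fill_chain : chains -> chains :=
  fglift fill.
HB.instance Definition _ := GRing.Linear.on fill_chain.

Lemma fill_chainU c : fill_chain << c >> = fill c.
Proof. exact: fgliftU. Qed.

Lemma fill_chain0 z :
  supported (fun c => subseq (etop c) wM) z -> fill_chain z = 0.
Proof.
apply: (eq_on_supported (F := fill_chain) (G := \0)) => c tc.
by rewrite /= fill_chainU /fill tc.
Qed.

Lemma fill_econs c : ~~ subseq (etop (econs a c)) wM ->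
  fill (econs a c) = valid_gen (eext a c).
Proof. by rewrite /fill econsK eqxx; case: ifP. Qed.

Lemma fill_eext c : valid (eext a c) -> fill (eext a c) = 0.
Proof.
move=> v; rewrite /fill; case: ifP => // _; case: eqP => // e.
by have [d ->] := econs_eq_eext v e; rewrite /valid_gen invalid_eext2.
Qed.

Lemma fill_chain_ext z : fill_chain (chain_ext a z) = 0.
Proof.
apply: (eq_on_generators (F := fill_chain \o chain_ext a) (G := \0)) => c /=.
rewrite chain_extU /valid_gen; case: ifP => [v|_]; rewrite ?raddf0 //.
by rewrite fill_chainU fill_eext.
Qed.

(** The blocks that remain once the blocks [a d] outside [W'] are filled. *)
Definition residual c : Prop := subseq (etop c) wM \/ exists d, c = eext a d.

(** In [d (e_a d') = a d' - d' - E (d d')], filling sends the first term back to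
[e_a d'], and kills the other two: [d'] lies in [W'], and the last term is made
of blocks beginning with [e_a]. So [fill_chain] after [boundary] is the
projection onto the residual blocks outside [W']. *)
Lemma fill_chain_boundary c : in_complex W c -> residual c ->
  fill_chain (block_boundary c) = if subseq (etop c) wM then 0 else << c >>.
Proof.
move=> Wc rc; have [v _ M] := (in_intervalP _ _ _).1 Wc; case: ifPn => [tc|ntc].
  apply: fill_chain0; apply: supported_weaken (boundary_faces v).
  move=> d [_ _ _ td].
  exact: subseq_trans tc.
case: rc ntc M => [-> //|[d ed]]; subst c => ntc.
rewrite etop_eext /= eqxx => td.
rewrite boundary_eext // !raddfB /= fill_chain_ext subr0 !fill_chainU.
rewrite fill_econs; last by rewrite etop_econs -etop_eext.
by rewrite {1}/fill td subr0 /valid_gen v.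
Qed.

Lemma chain_fill_chain k z : chain W k z -> chain W k.+1 (fill_chain z).
Proof.
apply: supported_linear => c [Wc dc]; rewrite /= fill_chainU /fill.
case: ifP => _; first exact: supported0.
case: eqP => ec; last exact: supported0.
rewrite /valid_gen; case: ifP => v; last exact: supported0.
apply: supportedU; split; last by rewrite edim_eext -dc -[in RHS]ec edim_econs.
by apply/in_W_eext; split=> //; apply/in_W_econs; rewrite ec.
Qed.

(** Subtracting [d (e_a d') = a d' - d' - E (d d')] from [a d'] leaves
[d' + E (d d')], where [d'] lies in [W'] and [E (d d')] consists of blocks
beginning with [e_a]. *)
Lemma chain_residual k z : chain W k.+1 z ->
  supported (fun c => (in_complex W c /\ edim c = k.+1) /\ residual c)
    (z - boundary (fill_chain z)).
Proof.
apply: (supported_linear (F := idfun \- (@boundary T \o fill_chain))).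
move=> c [Wc dc] /=.
have v : valid c by case: Wc.
rewrite fill_chainU; have [tc|ntc] := boolP (subseq (etop c) wM).
  by rewrite /fill tc raddf0 subr0; apply: supportedU; do ?split=> //; left.
case: (cylinder_cases Wc) => [|[d ed Wd]|[d ed Wd]].
- by rewrite (negbTE ntc).
- subst c; rewrite fill_econs // /valid_gen; case: ifPn => [vd|nvd].
    have [vd' mM] := Wd; rewrite edim_econs in dc.
    have td : subseq (etop d) wM by case/in_intervalP: Wd.
    rewrite boundaryU boundary_eext // !opprB.
    rewrite addrCA [X in _ + X]addrCA subrr addr0.
    apply: supportedD; last first.
      by apply: supportedU; split; [split=> //; apply: in_W|left].
    apply: supported_linear (boundary_faces vd') => e [ve de be te].
    rewrite /= chain_extU /valid_gen; case: ifP => vae; last exact: supported0.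
    apply: supportedU; split; last by right; exists e.
    split; last by rewrite edim_eext de.
    apply/in_W_eext; split=> //; apply/in_intervalP; split=> //.
      by case/in_intervalP: Wd => _ /subseq_trans m _; apply: m.
    exact: subseq_trans td.
  rewrite raddf0 subr0; apply: supportedU; split=> //; right.
  have [e ee] := invalid_eextP (proj1 Wd) nvd.
  by exists (econs a e); rewrite ee econs_eext.
subst c; rewrite fill_eext // raddf0 subr0; apply: supportedU; split=> //.
by right; exists d.
Qed.

Lemma edge_W u w : edge W' u w -> edge W u w.
Proof. by case=> c [/in_W Wc dc uw]; exists c. Qed.

Lemma edge_sym (V : word T -> Prop) u w : edge V u w -> edge V w u.
Proof.
case=> c [Vc dc uw]; exists c; split=> //.
by case: uw => -[-> ->]; [right|left].
Qed.

Lemma retract_word u : W u -> exists2 u', W' u' & u = u' \/ edge W u u'.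
Proof.
case: u => [|b u] /andP[mu uM].
  by exists [::]; [apply/andP; rewrite sub0seq|left].
have [e|ne] := eqVneq b a; last first.
  exists (b :: u); last by left.
  by apply/andP; move: uM => /=; rewrite (negbTE ne); split.
subst b; move: uM; rewrite /= eqxx => uM.
have Wu : W' u by apply/andP; rewrite -(subseq_skip _ wm_a).
exists u => //; right; exists (eext a (\pi_(eblock T) (Word u))); split.
- apply/in_W_eext; split; first by rewrite eext_pi validE.
  split; first by rewrite validE.
  by move=> _ [I ->]; rewrite evertex_pi.
- by rewrite edim_eext edim_pi.
by right; rewrite !evertex_eext !evertex_pi.
Qed.

(** For a cycle [z], the cycle [r = z - d (fill z)] is residual, and so is equal
to its part in [W'] plus [fill (d r) = 0]. *)
Lemma acyclic_cylinder : acyclic W' -> acyclic W.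
Proof.
move=> [conn van]; split=> [u w|k k0 z Wz dz].
  move=> /retract_word[u' Wu uu'] /retract_word[w' Ww ww'].
  apply: (@rt_trans _ _ u u').
    by case: uu' => [->|uu']; [apply: rt_refl|apply: rt_step].
  apply: (@rt_trans _ _ u' w'); last first.
    by case: ww' => [->|ww']; [apply: rt_refl|apply/rt_step/edge_sym].
  elim: (conn u' w' Wu Ww) => [x y xy|x|x v y _ IH1 _ IH2].
  - exact/rt_step/edge_W.
  - exact: rt_refl.
  exact: rt_trans IH1 IH2.
case: k k0 Wz => // k _ Wz.
have Wf := chain_fill_chain Wz.
set r := z - boundary (fill_chain z).
have Wr := chain_residual Wz; rewrite -/r in Wr.
have dr : boundary r = 0.
  rewrite raddfB /= dz boundary_boundary ?subrr //.
  by apply: supported_weaken Wf => c [[]].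
pose keep := fglift (fun c => if subseq (etop c) wM then << c >> else 0)
  : chains -> chains.
have rE : r = keep r.
  rewrite -[RHS]addr0 -(raddf0 fill_chain) -dr.
  apply: (eq_on_supported (F := idfun)
    (G := keep \+ (fill_chain \o @boundary T))) Wr => c [[Wc _] rc].
  rewrite /= /keep fgliftU boundaryU fill_chain_boundary //.
  by case: ifP; rewrite ?addr0 ?add0r.
have Wr' : chain W' k.+1 r.
  rewrite rE; apply: supported_linear Wr => c [[Wc dc] _].
  rewrite /keep /= fgliftU; case: ifP => tc; last exact: supported0.
  by apply: supportedU; split=> //; apply: in_W'.
have [y Wy dy] := van k.+1 isT r Wr' dr.
exists (y + fill_chain z); last by rewrite raddfD /= dy subrK.
apply: supportedD => //.
by apply: supported_weaken Wy => c [/in_W Wc ->].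
Qed.
End Cylinder.

End Intervals.

(** * Unique embeddings *)

Section Exponents.
Variable T : finType.
Implicit Types (a b : T) (w wm wM : word T) (s : seq T) (q r : seq nat).

Lemma acyclic_nil wm : acyclic (subword_interval wm [::]).
Proof.
split=> [u w /andP[_] + /andP[_]|k k0 z Wz _].
  by rewrite !subseq0 => /eqP -> /eqP ->; apply: rt_refl.
suff -> : z = 0 by exists 0; [apply: supported0|rewrite raddf0].
apply/eqP; rewrite -dom_eq0; case E: (dom z) => [//|c D].
have [|/in_intervalP[_ _]] := Wz c; first by rewrite E mem_head.
case: (eblock_case c) => [->|[b [d ->]]|[b [d ->]]].
- by rewrite edim_pi => _ k_0; rewrite -k_0 in k0.
- by rewrite etop_econs.
by rewrite etop_eext.
Qed.

Lemma powersS a k s r :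
  powers (a :: s) (k.+1 :: r) = a :: powers (a :: s) (k :: r).
Proof. by []. Qed.

Lemma all2_leqS k q r : all2 leq q (k :: r) -> all2 leq q (k.+1 :: r).
Proof. by case: q => //= q0 q /andP[/leqW ->]. Qed.

Lemma subseq_powers s r w : size r = size s -> subseq w (powers s r) ->
  exists q, all2 leq q r /\ w = powers s q.
Proof.
elim: s r w => [|a s IHs] [|r0 r] // w.
  by rewrite subseq0 => _ /eqP ->; exists [::].
case=> sz; elim: r0 w => [|k IHk] w.
  by move=> /(IHs r _ sz)[q [qr ->]]; exists (0%N :: q).
have [wa|wa] := eqVneq (ohead w) (Some a); last first.
  rewrite powersS subseq_skip // => /IHk[q [/all2_leqS qr ->]].
  by exists q.
case: w wa => // b w [->]; rewrite powersS /= eqxx.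
by move=> /IHk[[|q0 q] [qr ->]] //; exists (q0.+1 :: q).
Qed.

(** The uniqueness of the embedding, for any exponents [r]. Zero exponents are
allowed, so that letters can be removed from the first run one at a time. *)
Definition unique_exponents s r wm : Prop := forall q q',
  all2 leq q r -> all2 leq q' r ->
  wm = powers s q -> wm = powers s q' -> q = q'.

(** By induction on the length of the upper word. The exponents that compete for
a smaller [r] also compete for a larger one, so that the embedding stays unique
when a letter of the upper word is removed. When that letter is removed from
both words, competing exponents compete again after adding 1 to the first. *)
Lemma acyclic_powers s r wm : size r = size s -> unique_exponents s r wm ->
  acyclic (subword_interval wm (powers s r)).
Proof.
elim: s r wm => [|a s IHs] [|r0 r] // wm => [_ _|[sz]].
  exact: acyclic_nil.
elim: r0 wm => [|k IHk] wm inj.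
  apply: IHs => // q q' qr q'r wq wq'.
  by have [] := inj (0%N :: q) (0%N :: q') qr q'r wq wq'.
rewrite powersS; have [wa|wa] := eqVneq (ohead wm) (Some a); last first.
  apply: acyclic_cylinder => //; apply: IHk => q q'.
  by move=> /all2_leqS qr /all2_leqS q'r; apply: inj.
case: wm wa inj => // b w [->] inj.
apply: acyclic_cons => [v|]; last first.
  apply: IHk => -[|q0 q] [|q0' q'] // qr q'r wq wq'.
  by have [-> ->] := inj (q0.+1 :: q) (q0'.+1 :: q') qr q'r
    (congr1 (cons a) wq) (congr1 (cons a) wq').
(* A word [v] of the interval that does not begin with [a] would embed [wm] both
   with exponent zero and with a positive exponent on the first run. *)
case/andP=> wv vM; apply/eqP; apply: contraT => va.
have vr : subseq v (powers s r).
  move: vM; rewrite subseq_skip //.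
  by elim: (k) => [|j IHj] //; rewrite powersS subseq_skip.
have wr := subseq_trans wv vr.
have [q [qr wq]] := subseq_powers sz wr.
have [||[|q0 q'] [q'r wq']] := @subseq_powers (a :: s) (k :: r) w.
- by rewrite /= sz.
- apply: subseq_trans (subseq_cons w a) _; apply: subseq_trans wr _.
  exact: suffix_subseq.
- by [].
by have := inj (0%N :: q) (q0.+1 :: q') qr q'r wq (congr1 (cons a) wq').
Qed.

End Exponents.

Theorem theorem5p12 (T : finType) (wm wM : word T) :
  embeds_uniquely wm wM ->
  connected (subword_interval wm wM) /\
  forall i : nat, (1 <= i)%N -> homology_vanishes (subword_interval wm wM) i.
Proof.
case=> _ [s [r [[sz _ _ ->] [q0 [_ q0_uniq]]]]].
apply: acyclic_powers => // q q' qr q'r wq wq'.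
by rewrite -(q0_uniq q) // (q0_uniq q').
Qed.
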